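(* Let $A_C\in\mathbb{R}^{n\times n}$ be a companion matrix with characteristic polynomial $N(s)$ and simple spectrum $\lambda_1,\dots,\lambda_n$ satisfying $\lambda_i+\lambda_j\ne0$ for all $i,j$. If a non-zero initial condition given by an $n\times n$ matrix $P_C^0$ is specified, then the general solution $\tilde P_C(t)$ of $$-\frac{d\tilde P_C(t)}{dt}+A_C\tilde P_C(t)+\tilde P_C(t)A_C^T=-e_ne_n^T,\qquad \tilde P_C(0)=P_C^0,$$ consists of two parts, $\tilde P_C(t)=P_C(t)+P_C^0(t)$, where $P_C(t)$ is the solution of the same equation with zero initial condition $P_C(0)=0$, whose spectral decompositions are $$P_C(t)=\sum_{i=1}^n\left\{\frac{x_ix_i^T\mathcal{J}}{N'(\lambda_i)N(-\lambda_i)}\left(I-e^{(\lambda_iI+A_C^* )t}\right)\right\}_H=\sum_{i,j=1}^n\left\{\frac{e^{(\lambda_i+\lambda_j^* )t}-1}{\lambda_i+\lambda_j^*}\cdot\frac{x_ix_j^*}{N'(\lambda_i)N'(\lambda_j^* )}\right\}_H,$$ and $P_C^0(t)$ satisfies the Lyapunov equation with zero right-hand side, $-\frac{d}{dt}P_C^0(t)+A_CP_C^0(t)+P_C^0(t)A_C^T=0$, with initial condition $P_C^0(0)=P_C^0$. In this case the spectral decompositions of the second part have a similar form: $$P_C^0(t)=\sum_{i=1}^n\tilde P^C_{0\,i}(t)=\sum_{i=1}^n\left\{\frac{x_iy_i^T}{-N'(\lambda_i)}P_C^0\,e^{(\lambda_iI+A_C^* )t}\right\}_H,$$ $$P_C^0(t)=\sum_{i,j=1}^nP^C_{0\,ij}(t)=\sum_{i,j=1}^n\left\{\frac{x_iy_i^TP_C^0(y_j^T)^*x_j^*}{N'(\lambda_i)N'(\lambda_j^*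 )}\,e^{(\lambda_i+\lambda_j^* )t}\right\}_H ,$$ where $\tilde P^C_{0\,i}(t)$ and $P^C_{0\,ij}(t)$ denote the respective summands.
   Context: The companion matrix is $A_C=\begin{bmatrix}0_{(n-1)\times 1}&I_{(n-1)\times(n-1)}\\-a_0&-a_1\ \cdots\ -a_{n-1}\end{bmatrix}$ with real $a_0,\dots,a_{n-1}$, so $N(s)=\det(sI-A_C)=\sum_{k=0}^na_ks^k$ with $a_n=1$, and $N'$ is its derivative; $e_n=[0,\dots,0,1]^T$; $\mathcal{J}=\mathrm{diag}(-1,(-1)^2,\dots,(-1)^n)$. The vectors $x_i=[1,\lambda_i,\dots,\lambda_i^{n-1}]^T$ and $y_i=\lambda_i^{-n}\mathcal{H}_lx_i$ are right and left eigenvectors of $A_C$ for $\lambda_i$ (i.e. $A_Cx_i=\lambda_ix_i$, $y_i^TA_C=\lambda_iy_i^T$), where $\mathcal{H}_l$ is the $n\times n$ lower Hankel matrix with entries $(\mathcal{H}_l)_{rc}=a_{r+c-n-1}$ if $r+c\ge n+1$ and $0$ otherwise. $(\cdot)^*$ is the complex conjugate transpose (complex conjugate for scalars; so $(y_j^T)^*$ is the column vector of conjugates of the entries of $y_j$), and $\{M\}_H=\tfrac12(M+M^* )$ is the Hermitian part of $M$.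
   Formalization: In the first decomposition of P_C(t) the factor I−e^{(λ_i I+A_C^* )t} is replaced by e^{(λ_i I+A_C^* )t}−I (printed sign is wrong); the decompositions of P_C^0(t) are stated for Hermitian P_C^0, and for arbitrary P_C^0 they give the Hermitian part of P_C^0(t). *)

(* Defs.v *)
(* MathComp / MathComp-Analysis. *)
From HB Require Import structures.
From mathcomp Require Import all_boot all_order all_algebra.
From mathcomp Require Import all_classical all_reals all_analysis.
From mathcomp Require Import complex.

Set Implicit Arguments.
Unset Strict Implicit.
Unset Printing Implicit Defensive.

Import Order.TTheory GRing.Theory Num.Theory numFieldNormedType.Exports.
Local Open Scope classical_set_scope.
Local Open Scope ring_scope.
Local Open Scope sesquilinear_scope.

(* R[i] packed as a numClosedFieldType: MathComp-Analysis then equips Cx R and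
   the matrices over it with the topology of the complex modulus, which it does
   not find on the bare type R[i]. *)
Definition Cx (R : realType) : numClosedFieldType := R[i]%C.

Definition toC (R : realType) (x : R) : Cx R := real_complex R x.

(* Matrices have size n.+1 since the order must be positive; rows and columns
   are indexed from 0. *)

Definition cexp (R : realType) (z : Cx R) : Cx R :=
  limn (series (fun k : nat => z ^+ k / k`!%:R)).

Definition mexp (R : realType) (n : nat) (M : 'M[Cx R]_n.+1) : 'M[Cx R]_n.+1 :=
  limn (series (fun k : nat => k`!%:R^-1 *: M ^+ k)).

Definition hermPart (R : realType) (n : nat) (M : 'M[Cx R]_n) : 'M[Cx R]_n :=
  2^-1 *: (M + M ^t*).

Section Companion.
Variables (R : realType) (n : nat) (a : 'I_n.+1 -> R).
Implicit Type l : Cx R.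

(* The companion matrix of 'X^n.+1 + \sum_(k < n.+1) a k *: 'X^k. *)
Definition companion : 'M[Cx R]_n.+1 :=
  \matrix_(i, j) if i == ord_max then - toC (a j) else (j == i.+1 :> nat)%:R.

Definition evec : 'cV[Cx R]_n.+1 := delta_mx ord_max 0.

Definition xvec l : 'cV[Cx R]_n.+1 := \col_i l ^+ i.

(* With indices from 0, the condition r + c >= (order) + 1 reads n <= r + c and
   the index r + c - (order) - 1 reads r + c - n. *)
Definition lowerHankel : 'M[Cx R]_n.+1 :=
  \matrix_(r, c) if (n <= r + c)%N then toC (a (inord (r + c - n))) else 0.

Definition yvec l : 'cV[Cx R]_n.+1 := l ^- n.+1 *: (lowerHankel *m xvec l).

(* The first diagonal entry is -1, so that xvec (- l) = - (signMx *m xvec l). *)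
Definition signMx : 'M[Cx R]_n.+1 := diag_mx (\row_i (-1) ^+ i.+1).

Definition charN : {poly Cx R} := char_poly companion.

(* e^((l I + A^* ) t) *)
Definition shiftExp l (t : R) : 'M[Cx R]_n.+1 :=
  mexp (toC t *: (l%:M + companion ^t*)).

(* The difference is e^(...) - I and not I - e^(...): since signMx starts with
   -1, e_n^T (l I + A^* )^-1 = (xvec l)^T signMx / N(- l), and the integral over
   [0, t] of e^((l I + A^* ) s) is (l I + A^* )^-1 (e^((l I + A^* ) t) - I).
   For the 1 x 1 matrix A = - a, this is the factor making the sum equal to
   (1 - e^(-2 a t)) / (2 a) instead of its opposite. *)
Definition PCterm1 l (t : R) : 'M[Cx R]_n.+1 :=
  hermPart ((charN^`().[l] * charN.[- l])^-1 *:
    (xvec l *m (xvec l)^T *m signMx *m (shiftExp l t - 1%:M))).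

Definition PCterm2 l m (t : R) : 'M[Cx R]_n.+1 :=
  hermPart (((cexp ((l + m^*) * toC t) - 1) / (l + m^*)) *:
    ((charN^`().[l] * charN^`().[m^*])^-1 *: (xvec l *m (xvec m) ^t*))).

Definition P0term1 (P0 : 'M[Cx R]_n.+1) l (t : R) : 'M[Cx R]_n.+1 :=
  hermPart ((- charN^`().[l])^-1 *:
    (xvec l *m (yvec l)^T *m P0 *m shiftExp l t)).

Definition P0term2 (P0 : 'M[Cx R]_n.+1) l m (t : R) : 'M[Cx R]_n.+1 :=
  hermPart (cexp ((l + m^*) * toC t) *:
    ((charN^`().[l] * charN^`().[m^*])^-1 *:
      (xvec l *m (yvec l)^T *m P0 *m (yvec m)^T ^t* *m (xvec m) ^t*))).

End Companion.

(* D is the derivative of P at t along the interval J: two-sided at interior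
   points, one-sided at endpoints. *)
Definition has_derivative_in (R : realType) (n : nat) (J : interval R)
    (P : R -> 'M[Cx R]_n.+1) (t : R) (D : 'M[Cx R]_n.+1) : Prop :=
  (fun s : R => toC (s - t)^-1 *: (P s - P t)) @ within [set` J] t^' --> D.

(* P solves - dP/dt + A P + P A^T = - Q on J with P 0 = P0. *)
Definition lyapunov_solution (R : realType) (n : nat) (J : interval R)
    (A Q P0 : 'M[Cx R]_n.+1) (P : R -> 'M[Cx R]_n.+1) : Prop :=
  P 0 = P0 /\
  forall t : R, t \in J -> exists2 D : 'M[Cx R]_n.+1,
    has_derivative_in J P t D & - D + A *m P t + P t *m A^T = - Q.

Definition the_lyapunov_solution (R : realType) (n : nat) (J : interval R)
    (A Q P0 : 'M[Cx R]_n.+1) (P : R -> 'M[Cx R]_n.+1) : Prop :=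
  lyapunov_solution J A Q P0 P /\
  forall P' : R -> 'M[Cx R]_n.+1,
    lyapunov_solution J A Q P0 P' -> {in J, P' =1 P}.

(* Main.v *)
Require Import Defs.
From HB Require Import structures.
From mathcomp Require Import all_boot all_order all_algebra.
From mathcomp Require Import all_classical all_reals all_analysis.
From mathcomp Require Import complex.
From mathcomp Require Import ring zify.

Import Order.TTheory GRing.Theory Num.Theory numFieldNormedType.Exports.
Local Open Scope ring_scope.
Local Open Scope sesquilinear_scope.

(** The solution is computed in the eigenspaces of the Lyapunov operator. The
    companion matrix A has the spectral projections
    P_i = - x_i y_i^T / N'(l_i): the entries of y_i are, up to sign, the
    coefficients of N / (X - l_i) (mulXB_ypoly), so y_i^T x_j vanishes for
    i <> j and equals - N'(l_i) for i = j, and the P_i sum to the identity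
    (sum_eigproj). As A is real, the operator X |-> A X + X A^T multiplies
    P_i X P_j^* by w = l_i + conj l_j, and the matrix equation becomes the
    scalar equations f' = w f for the initial condition and f' = w f + 1 for the
    input (lyapSum_solution). Their solutions exp(w t) and (exp(w t) - 1) / w
    give the double sums; w is not 0 because the conjugate of a root of the real
    polynomial N is again a root. Uniqueness on any interval containing 0 follows
    coordinatewise: multiplied by exp(- w t), a solution of f' = w f has zero
    derivative (lyapunov_homogeneous_eq0).

    The single sums contain the matrix exponential of t (l_i I + A^T), which is
    the sum over j of exp(w t) P_j^* (mexp_spectral). For the free motion this is
    the double sum again. For the forced motion, the row x_i^T signMx / N(- l_i)
    is e_n^T (l_i I + A^T)^-1, since A x(m) = m x(m) - N(m) e_n at m = - l_i
    (xvec_signMx_eigproj), and this resolvent supplies the factors 1 / w. The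
    forced motion is Hermitian, and so is the free motion when the initial
    matrix is, so that there taking Hermitian parts changes nothing.

    The complex exponential is a limit of partial sums; its derivative along the
    real line comes from the real power series of the real parts of
    u exp(w t) (is_derive_Re_cexp). *)

Set Implicit Arguments.
Unset Strict Implicit.
Unset Printing Implicit Defensive.

(** * Limits in the complex plane *)

Section ComplexLimits.
Local Open Scope classical_set_scope.
Variable R : realType.
Local Notation C := (Cx R).
Local Notation Re := (@complex.Re R).
Local Notation Im := (@complex.Im R).

HB.instance Definition _ := GRing.RMorphism.copy (@toC R) (real_complex R).

Lemma norm_toC (x : R) : `|toC x| = toC `|x|.
Proof. by rewrite /toC normc_def /= expr0n addr0 sqrtr_sqr. Qed.

Lemma conj_toC (x : R) : (toC x)^* = toC x.
Proof.
rewrite conj_Creal //; apply/complex_realP; by exists x.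
Qed.

Lemma ltr_toC (x y : R) : (toC x < toC y) = (x < y).
Proof. exact: ltcR. Qed.

Lemma ler_toC (x y : R) : (toC x <= toC y) = (x <= y).
Proof. exact: lecR. Qed.

Lemma gt0_toC (e : C) : 0 < e -> exists2 r : R, 0 < r & e = toC r.
Proof.
case: e => r s; rewrite ltcE /= => /andP[/eqP-> r0].
by exists r.
Qed.

Lemma normr_Re_le (z : C) : toC `|Re z| <= `|z|.
Proof. exact: normc_ge_Re. Qed.

Lemma normr_Im_le (z : C) : toC `|Im z| <= `|z|.
Proof.
have := normc_ge_Re (z * 'i%C).
by rewrite ReiNIm normrN normrM complexiE normCi mulr1.
Qed.

Lemma eq_ReIm (z w : C) : Re z = Re w -> Im z = Im w -> z = w.
Proof. by case: z => ? ?; case: w => ? ? /= -> ->. Qed.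

Lemma cvg_toC (T : Type) (F : set_system T) (FF : Filter F) (f : T -> R) (l : R) :
  f @ F --> l -> toC (f x) @[x --> F] --> toC l.
Proof.
move=> /cvgrPdist_lt fl; apply/cvgrPdist_lt => _ /gt0_toC[e e0 ->].
apply: filterS (fl e e0) => x.
by rewrite -rmorphB norm_toC ltr_toC.
Qed.

Lemma cvg_Re (T : Type) (F : set_system T) (FF : Filter F) (f : T -> C) (l : C) :
  f @ F --> l -> Re (f x) @[x --> F] --> Re l.
Proof.
move=> /cvgrPdist_lt fl; apply/cvgrPdist_lt => e e0.
have te0 : 0 < toC e by rewrite -[0](rmorph0 (@toC R)) ltr_toC.
apply: filterS (fl _ te0) => x /(le_lt_trans (normr_Re_le _)).
by rewrite ltr_toC; case: (f x); case: l {fl}.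
Qed.

Lemma cvg_Im (T : Type) (F : set_system T) (FF : Filter F) (f : T -> C) (l : C) :
  f @ F --> l -> Im (f x) @[x --> F] --> Im l.
Proof.
move=> /cvgrPdist_lt fl; apply/cvgrPdist_lt => e e0.
have te0 : 0 < toC e by rewrite -[0](rmorph0 (@toC R)) ltr_toC.
apply: filterS (fl _ te0) => x /(le_lt_trans (normr_Im_le _)).
by rewrite ltr_toC; case: (f x); case: l {fl}.
Qed.

Lemma complexE_toC (z : C) : z = toC (Re z) + 'i * toC (Im z).
Proof. by rewrite -complexiE; exact: complexE. Qed.

(** Convergence is tested on the two coordinates, so that the real theory of
    power series applies to complex sums. *)
Lemma cvg_ReIm (T : Type) (F : set_system T) (FF : Filter F) (f : T -> C) (l : C) :
  Re (f x) @[x --> F] --> Re l -> Im (f x) @[x --> F] --> Im l -> f @ F --> l.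
Proof.
move=> /cvg_toC fa /cvg_toC fb.
have -> : l = toC (Re l) + 'i * toC (Im l) by exact: complexE_toC.
have -> : f = fun x => toC (Re (f x)) + 'i * toC (Im (f x)).
  by apply/funext => x; rewrite -complexE_toC.
apply: cvgD; first exact: fa.
apply: cvgM; first exact: cvg_cst.
exact: fb.
Qed.

End ComplexLimits.

(** * The complex exponential *)

Section ComplexExponential.
Local Open Scope classical_set_scope.
Variable R : realType.
Local Notation C := (Cx R).
Local Notation Re := (@complex.Re R).
Local Notation Im := (@complex.Im R).

Lemma Re_toCM (r : R) (z : C) : Re (toC r * z) = r * Re z.
Proof. by case: z => x y /=; rewrite mul0r subr0. Qed.

Lemma Im_toCM (r : R) (z : C) : Im (toC r * z) = r * Im z.
Proof. by case: z => x y /=; rewrite mul0r addr0. Qed.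

(** The imaginary part is a real part after a rotation, which lets one family of
    real power series serve for both coordinates. *)
Lemma Im_Re (z : C) : Im z = Re (- 'i * z).
Proof.
rewrite -complexiE; case: z => x y /=.
by rewrite oppr0 mul0r sub0r mulN1r opprK.
Qed.

Lemma ReB (z w : C) : Re (z - w) = Re z - Re w.
Proof. by case: z; case: w. Qed.

Lemma ImB (z w : C) : Im (z - w) = Im z - Im w.
Proof. by case: z; case: w. Qed.

Definition cexp_coeff (u w : C) (k : nat) : R := Re (u * (w ^+ k / k`!%:R)).

Definition cexp_sum (w : C) : C ^nat := series (fun k => w ^+ k / k`!%:R).

Lemma pseries_cexp_coeff (u w : C) (x : R) (n : nat) :
  pseries (cexp_coeff u w) x n = Re (u * cexp_sum (w * toC x) n).
Proof.
rewrite /pseries /cexp_sum /series /=; elim: n => [|n IH].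
  by rewrite !big_geq // mulr0.
rewrite !big_nat_recr //= mulrDr IH /cexp_coeff.
rewrite [X in _ = Re (_ + X)](_ : _ = toC (x ^+ n) * (u * (w ^+ n / n`!%:R))).
  by rewrite [in RHS]raddfD /= Re_toCM [X in _ = _ + X]mulrC.
rewrite exprMn -rmorphXn /= [RHS]mulrC -!mulrA; congr (_ * (_ * _)).
by rewrite mulrC.
Qed.

(** Termwise differentiation only multiplies u by w: the family of coefficients
    is closed under the differentiation of power series. *)
Lemma pseries_diffs_cexp_coeff (u w : C) :
  pseries_diffs (cexp_coeff u w) = cexp_coeff (u * w) w.
Proof.
apply/funext => k; rewrite /pseries_diffs /cexp_coeff -Re_toCM; congr Re.
have kn0 : (k.+1%:R : C) != 0 by rewrite pnatr_eq0.
rewrite rmorph_nat factS natrM invfM exprS mulrCA -!mulrA; congr (_ * _).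
rewrite mulrCA; congr (_ * _); rewrite mulrCA; congr (_ * _).
by rewrite mulVKf.
Qed.

(** Domination by the real exponential series of |w| |x|, up to the factor |u|. *)
Lemma is_cvg_cexp_coeff (u w : C) (x : R) : cvgn (pseries (cexp_coeff u w) x).
Proof.
have [U U0 uU] : exists2 U : R, 0 <= U & `|u| = toC U.
  by exists (Num.sqrt (Re u ^+ 2 + Im u ^+ 2)); rewrite ?sqrtr_ge0 // normc_def.
have [W W0 wW] : exists2 W : R, 0 <= W & `|w| = toC W.
  by exists (Num.sqrt (Re w ^+ 2 + Im w ^+ 2)); rewrite ?sqrtr_ge0 // normc_def.
apply: normed_cvg.
apply: (@series_le_cvg _ _ (U *: exp_coeff (W * `|x|))).
- by move=> n /=.
- move=> n; apply: mulr_ge0 => //; apply: mulr_ge0; rewrite ?invr_ge0 //.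
  by apply: exprn_ge0; rewrite mulr_ge0.
- move=> n /=; rewrite normrM.
  have : `|cexp_coeff u w n| <= U * (W ^+ n / n`!%:R).
    rewrite -ler_toC (le_trans (normr_Re_le _)) // !normrM normrX normfV.
    by rewrite uU wW normr_nat !rmorphM fmorphV rmorphXn rmorph_nat.
  move=> /(ler_wpM2r (normr_ge0 (x ^+ n))) /le_trans; apply.
  rewrite -[leRHS]/(U * ((W * `|x|) ^+ n / n`!%:R)) normrX exprMn -!mulrA.
  by rewrite [_^-1 * _]mulrC.
- by apply: is_cvg_seriesZ; exact: is_cvg_series_exp_coeff.
Qed.

Lemma cvg_cexp_toC (w : C) (x : R) :
  cexp_sum (w * toC x) @ \oo --> cexp (w * toC x).
Proof.
apply/cvg_ex; exists (Complex (limn (pseries (cexp_coeff 1 w) x))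
                              (limn (pseries (cexp_coeff (- 'i) w) x))).
apply: cvg_ReIm.
- rewrite (_ : (fun n => _) = pseries (cexp_coeff 1 w) x).
    exact: is_cvg_cexp_coeff.
  by apply/funext => n; rewrite pseries_cexp_coeff mul1r.
- rewrite (_ : (fun n => _) = pseries (cexp_coeff (- 'i) w) x).
    exact: is_cvg_cexp_coeff.
  by apply/funext => n; rewrite pseries_cexp_coeff Im_Re.
Qed.

Lemma cvg_cexp (z : C) : cexp_sum z @ \oo --> cexp z.
Proof. by have := @cvg_cexp_toC z 1; rewrite rmorph1 mulr1. Qed.

Lemma Re_cexp (u w : C) (x : R) :
  Re (u * cexp (w * toC x)) = limn (pseries (cexp_coeff u w) x).
Proof.
apply/esym/cvg_lim => //.
rewrite (_ : pseries _ _ = fun n => Re (u * cexp_sum (w * toC x) n)); last first.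
  by apply/funext => n; rewrite pseries_cexp_coeff.
apply: cvg_Re; apply: cvgM; first exact: cvg_cst.
exact: cvg_cexp.
Qed.

(** Along a real variable, the real part of u exp(w x) is a real power series;
    differentiating it termwise gives the real part of u w exp(w x). *)
Lemma is_derive_Re_cexp (u w : C) (x : R) :
  is_derive x 1 (fun y => Re (u * cexp (w * toC y)))
    (Re (u * (w * cexp (w * toC x)))).
Proof.
have -> : Re (u * (w * cexp (w * toC x))) =
    limn (pseries (pseries_diffs (cexp_coeff u w)) x).
  by rewrite pseries_diffs_cexp_coeff -Re_cexp mulrA.
rewrite (_ : (fun y => _) = fun y => limn (pseries (cexp_coeff u w) y)); last first.
  by apply/funext => y; rewrite Re_cexp.
(* Any radius larger than |x| will do, since the series converges everywhere. *)
apply: (@pseries_snd_diffs _ _ (`|x| + 1)).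
- exact: is_cvg_cexp_coeff.
- rewrite pseries_diffs_cexp_coeff; exact: is_cvg_cexp_coeff.
- rewrite !pseries_diffs_cexp_coeff; exact: is_cvg_cexp_coeff.
- by rewrite [ltRHS]ger0_norm ?addr_ge0 // ltrDl.
Qed.

Lemma cexp0 : cexp (0 : C) = 1.
Proof.
apply: cvg_lim => //; rewrite -/(cexp_sum 0) -cvg_shiftS.
rewrite (_ : [sequence _]_n = fun=> 1); first exact: cvg_cst.
apply/funext => n /=; rewrite /cexp_sum /series /= big_nat_recl //= expr0 divr1.
by rewrite big1 ?addr0 // => k _; rewrite expr0n mul0r.
Qed.

Lemma conj_cexp (z : C) : (cexp z)^* = cexp z^*.
Proof.
apply/esym/cvg_lim => //; rewrite -/(cexp_sum z^* ).
apply/cvgrPdist_lt => e e0.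
have /cvgrPdist_lt/(_ e e0) := @cvg_cexp z.
apply: filterS => n.
rewrite (_ : cexp_sum z^* n = (cexp_sum z n)^*).
  by rewrite -rmorphB norm_conjC.
rewrite /cexp_sum /series /= rmorph_sum; apply: eq_bigr => k _.
by rewrite rmorphM fmorphV rmorphXn rmorph_nat.
Qed.

End ComplexExponential.

(** * Derivatives along an interval *)

Section DerivativeWithin.
Local Open Scope classical_set_scope.
Variables (R : realType) (J : interval R).
Local Notation C := (Cx R).
Local Notation Re := (@complex.Re R).
Local Notation Im := (@complex.Im R).

Lemma is_derive_quotient (g : R -> R) (t d : R) :
  is_derive t 1 g d -> (s - t)^-1 * (g s - g t) @[s --> t^'] --> d.
Proof.
move=> gd; have /cvg_ex[l gl] := @ex_derive _ _ _ _ _ _ _ gd.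
have <- : l = d by rewrite -(@derive_val _ _ _ _ _ _ _ gd); apply/esym/cvg_lim.
move=> A /gl; rewrite /= /nbhs /= => -[e /= e0 eA].
exists e => // s /= ts st; have := eA (s - t).
rewrite /= /ball /= sub0r opprB => /(_ ts); rewrite subr_eq0 => /(_ st).
by rewrite -[_ *: 1]/(_ * 1) mulr1 subrK.
Qed.

Lemma quotient_is_derive (g : R -> R) (t d : R) :
  (s - t)^-1 * (g s - g t) @[s --> t^'] --> d -> is_derive t 1 g d.
Proof.
move=> gd.
have gl : h^-1 *: (g (h *: 1 + t) - g t) @[h --> 0^'] --> d.
  move=> A /gd; rewrite /= /nbhs /= => -[e /= e0 eA].
  exists e => // s /= ts st; have := eA (s + t).
  rewrite /= /ball /= opprD addrCA subrr addr0 -sub0r => /(_ ts).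
  rewrite addrK -[_ *: 1]/(_ * 1) mulr1; apply.
  by rewrite -subr_eq0 addrK.
apply: DeriveDef; first by apply/cvg_ex; exists d.
exact: cvg_lim gl.
Qed.

(** Scalar form of has_derivative_in: one-sided at an endpoint of J that belongs
    to J. *)
Definition sderivative (f : R -> C) (t : R) (d : C) : Prop :=
  toC (s - t)^-1 * (f s - f t) @[s --> within [set` J] t^'] --> d.

Lemma cvg_within_dnbhs (f : R -> C) (D : set R) (t : R) (l : C) :
  f @ t^' --> l -> f @ within D t^' --> l.
Proof. by move=> fl; apply: cvg_trans fl; apply: cvg_app; exact: cvg_within. Qed.

Lemma sderivative_cexp (w : C) (t : R) :
  sderivative (fun s => cexp (w * toC s)) t (w * cexp (w * toC t)).
Proof.
apply: cvg_within_dnbhs.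
apply: cvg_ReIm.
  under eq_fun do rewrite Re_toCM ReB.
  apply: is_derive_quotient; have := is_derive_Re_cexp 1 w t.
  by rewrite mul1r; under eq_fun do rewrite mul1r.
under eq_fun do rewrite Im_toCM ImB.
apply: is_derive_quotient; have := is_derive_Re_cexp (- 'i) w t.
by rewrite -Im_Re; under eq_fun do rewrite -Im_Re.
Qed.

Lemma sderivative_continuous (f : R -> C) (t : R) (d : C) :
  sderivative f t d -> f s @[s --> within [set` J] t^'] --> f t.
Proof.
move=> fd.
have E : {near within [set` J] t^',
    (fun s => toC (s - t) * (toC (s - t)^-1 * (f s - f t)) + f t) =1 f}.
  apply: cvg_within; exists 1 => //= s _ st.
  by rewrite mulrA -rmorphM mulfV ?subr_eq0 // rmorph1 mul1r subrK.
have -> : f t = toC 0 * d + f t by rewrite rmorph0 mul0r add0r.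
apply: (cvg_trans (near_eq_cvg E)).
apply: cvgD; last exact: cvg_cst.
apply: cvgM; last exact: fd.
apply: cvg_toC; rewrite -(subrr t); apply: cvgB; last exact: cvg_cst.
apply: cvg_trans (cvg_within _) _; exact: nbhs_dnbhs.
Qed.

Lemma sderivativeM (f g : R -> C) (t : R) (df dg : C) :
  sderivative f t df -> sderivative g t dg ->
  sderivative (fun s => f s * g s) t (df * g t + f t * dg).
Proof.
move=> fd gd; have gc := sderivative_continuous gd.
rewrite /sderivative.
rewrite (_ : (fun s => _) = fun s => toC (s - t)^-1 * (f s - f t) * g s +
                                     f t * (toC (s - t)^-1 * (g s - g t))).
  apply: cvgD; first by apply: cvgM; [exact: fd | exact: gc].
  by apply: cvgM; [exact: cvg_cst | exact: gd].
by apply/funext => s; ring.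
Qed.

(** The mean value theorem on [x, y]. Only the derivative along J is known, which
    is two-sided on ]x, y[ and gives continuity at x and y. *)
Lemma real_quotient0_eq (g : R -> R) (x y : R) : x < y -> x \in J -> y \in J ->
  (forall t, t \in J ->
    (s - t)^-1 * (g s - g t) @[s --> within [set` J] t^'] --> 0) ->
  g x = g y.
Proof.
move=> xy xJ yJ g0.
have sub t : x <= t <= y -> t \in J.
  by move=> xty; exact: (interval_is_interval xJ yJ xty).
have gd t : t \in `]x, y[%R -> is_derive t 1 g 0.
  rewrite in_itv /= => /andP[xt ty]; apply: quotient_is_derive.
  have tJ : t \in J by apply: sub; rewrite !ltW.
  move=> A /(g0 t tJ); rewrite /= => BA.
  have : t^' [set s | s \in J].
    have : \forall s \near t, s \in `]x, y[%R.
      by apply: near_in_itvoo; rewrite in_itv /= xt ty.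
    move=> /nbhs_dnbhs; apply: filterS => s; rewrite in_itv /= => /andP[xs sy].
    by apply: sub; rewrite !ltW.
  have {}BA : \forall s \near t^', s \in J -> A ((s - t)^-1 * (g s - g t)) := BA.
  by move=> BJ; apply: filterS2 BJ BA => s /[swap] /[apply].
have gc : {within `[x, y], continuous g}.
  (* A difference quotient tending to 0 is eventually at most 1 in modulus, so g
     is locally 1-Lipschitz at t along J. *)
  have gt t : t \in J -> \forall s \near t, s \in J -> `|g t - g s| <= `|s - t|.
    move=> tJ; have /cvgrPdist_le/(_ _ ltr01) H := g0 t tJ.
    have {}H : \forall s \near t, s != t -> s \in J ->
      `|0 - (s - t)^-1 * (g s - g t)| <= 1 := H.
    apply: filterS H => s gs sJ.
    have [->|st] := eqVneq s t; first by rewrite !subrr.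
    move: (gs st sJ); rewrite sub0r normrN normrM normfV [`|g s - _|]distrC.
    by rewrite ler_pdivrMl ?mulr1 // normr_gt0 subr_eq0.
  have gc t (F : set_system R) : Filter F -> t \in J -> F `=>` nbhs t ->
      F [set s | s \in J] -> g s @[s --> F] --> g t.
    move=> FF tJ Ft FJ; apply/cvgrPdist_lt => e e0.
    have nt : \forall s \near t, `|s - t| < e.
      by exists e => //= s; rewrite /ball /= distrC.
    apply: filterS3 FJ (Ft _ (gt t tJ)) (Ft _ nt) => s sJ /(_ sJ).
    exact: le_lt_trans.
  apply/continuous_within_itvP => //; split.
  - move=> t xty; have tJ : t \in J.
      by apply: sub; move: xty; rewrite in_itv /= => /andP[? ?]; rewrite !ltW.
    apply: gc => //; near=> s; apply: sub.
    have : s \in `]x, y[%R by near: s; exact: near_in_itvoo.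
    by rewrite in_itv /= => /andP[? ?]; rewrite !ltW.
  - apply: gc => //; first exact: cvg_within.
    near=> s; apply: sub; apply/andP; split; first by near: s; exact: nbhs_right_ge.
    by near: s; exact: nbhs_right_le.
  - apply: gc => //; first exact: cvg_within.
    near=> s; apply: sub; apply/andP; split; last by near: s; exact: nbhs_left_le.
    by near: s; exact: nbhs_left_ge.
have [c _] := MVT xy gd gc.
by rewrite mul0r => /eqP; rewrite subr_eq0 => /eqP.
Unshelve. all: by end_near. Qed.

Lemma sderivative0_eq (f : R -> C) :
  (forall t, t \in J -> sderivative f t 0) -> {in J &, forall x y, f x = f y}.
Proof.
move=> f0.
suff lt x y : x < y -> x \in J -> y \in J -> f x = f y.
  move=> x y xJ yJ; have [xy|yx|-> //] := ltgtP x y; first exact: lt.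
  by apply/esym/lt.
move=> xy xJ yJ; apply: eq_ReIm.
  apply: (real_quotient0_eq (g := fun s => Re (f s))) xy xJ yJ _ => t tJ.
  have : Re (toC (s - t)^-1 * (f s - f t)) @[s --> within [set` J] t^'] --> 0.
    exact: (@cvg_Re _ _ _ _ _ _ (f0 t tJ)).
  by under eq_fun do rewrite Re_toCM ReB.
apply: (real_quotient0_eq (g := fun s => Im (f s))) xy xJ yJ _ => t tJ.
have : Im (toC (s - t)^-1 * (f s - f t)) @[s --> within [set` J] t^'] --> 0.
  exact: (@cvg_Im _ _ _ _ _ _ (f0 t tJ)).
by under eq_fun do rewrite Im_toCM ImB.
Qed.

End DerivativeWithin.

Arguments sderivative_cexp {R} J w t _ _.
Arguments sderivativeM {R J f g t df dg} _ _ _ _.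

(** The product has zero derivative on the whole line and equals 1 at 0. *)
Lemma cexp_mulN (R : realType) (w : Cx R) (t : R) :
  cexp (w * toC t) * cexp (- w * toC t) = 1.
Proof.
pose J : interval R := `]-oo, +oo[%R.
have inJ s : s \in J by rewrite in_itv.
pose f s := cexp (w * toC s) * cexp (- w * toC s).
have f0 s : sderivative J f s 0.
  have Z (a b : Cx R) : 0 = w * a * b + a * (- w * b) by ring.
  rewrite [X in sderivative J f s X](Z (cexp (w * toC s)) (cexp (- w * toC s))).
  exact: (sderivativeM (sderivative_cexp J w s) (sderivative_cexp J (- w) s)).
have E : f t = f 0 by exact: (sderivative0_eq (fun s _ => f0 s) (inJ t) (inJ 0)).
rewrite -/(f t) E.
by rewrite /f rmorph0 !mulr0 cexp0 mulr1.
Qed.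

(** Multiplying q by exp(- w t) gives a function with zero derivative. *)
Lemma scalar_ode_eq0 (R : realType) (J : interval R) (w : Cx R)
    (q : R -> Cx R) : 0 \in J -> q 0 = 0 ->
  (forall t, t \in J -> sderivative J q t (w * q t)) -> {in J, forall t, q t = 0}.
Proof.
move=> J0 q0 qd t tJ.
pose f s := q s * cexp (- w * toC s).
have f0 s : s \in J -> sderivative J f s 0.
  move=> sJ.
  have <- : w * q s * cexp (- w * toC s) +
            q s * (- w * cexp (- w * toC s)) = 0 by ring.
  exact: (sderivativeM (qd s sJ) (sderivative_cexp J (- w) s)).
have E : f t = f 0 by exact: (sderivative0_eq f0 tJ J0).
by rewrite -[q t]mulr1 -(cexp_mulN w t) mulrCA -/(f t) E /f q0 mul0r mulr0.
Qed.

(** * Conjugate transposes, matrix limits and matrix exponentials *)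

Section Matrices.
Local Open Scope classical_set_scope.

Lemma cvg_sumr (K : numFieldType) (V : normedModType K) (I T : Type)
    (F : set_system T) (FF : Filter F) (s : seq I) (f : I -> T -> V) (l : I -> V) :
  (forall i, f i x @[x --> F] --> l i) ->
  \sum_(i <- s) f i x @[x --> F] --> \sum_(i <- s) l i.
Proof.
move=> fl; elim: s => [|i s IH].
  rewrite big_nil; under eq_fun do rewrite big_nil; exact: cvg_cst.
rewrite big_cons; under eq_fun do rewrite big_cons.
by apply: cvgD; [exact: fl | exact: IH].
Qed.

Variables (R : realType) (n : nat).
Local Notation C := (Cx R).
Local Notation M := 'M[C]_n.+1.

Lemma adjM (m p q : nat) (X : 'M[C]_(m, p)) (Y : 'M[C]_(p, q)) :
  (X *m Y) ^t* = Y ^t* *m X ^t*.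
Proof. by rewrite trmx_mul map_mxM. Qed.

Lemma adjZ (m p : nat) (c : C) (X : 'M[C]_(m, p)) : (c *: X) ^t* = c^* *: X ^t*.
Proof. by rewrite linearZ map_mxZ. Qed.

Lemma adj_sum (m p : nat) (I : Type) (s : seq I) (X : I -> 'M[C]_(m, p)) :
  (\sum_(i <- s) X i) ^t* = \sum_(i <- s) (X i) ^t*.
Proof. by rewrite linear_sum raddf_sum. Qed.

Lemma hermPart_sum (I : Type) (s : seq I) (X : I -> M) :
  hermPart (\sum_(i <- s) X i) = \sum_(i <- s) hermPart (X i).
Proof. by rewrite /hermPart adj_sum -big_split /= scaler_sumr. Qed.

Lemma hermPart_id (X : M) : X ^t* = X -> hermPart X = X.
Proof.
move=> XX; rewrite /hermPart XX -[X + X]/(X *+ 2) -[X *+ 2]scaler_nat.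
by rewrite scalerA mulVf ?scale1r.
Qed.

(** Bilinear coordinates of a convergent matrix function converge, which reduces
    matrix equations to scalar ones. *)
Lemma cvg_mulmx_entry (T : Type) (F : set_system T) (FF : Filter F)
    (f : T -> M) (l U V : M) (i j : 'I_n.+1) :
  f @ F --> l -> (U *m f x *m V) i j @[x --> F] --> (U *m l *m V) i j.
Proof.
move=> fl.
have E (X : M) : (U *m X *m V) i j = \sum_k \sum_h U i h * X h k * V k j.
  by rewrite mxE; apply: eq_bigr => k _; rewrite mxE mulr_suml.
rewrite E; under eq_fun do rewrite E.
apply: cvg_sumr => k; apply: cvg_sumr => h.
apply: cvgM; last exact: cvg_cst.
apply: cvgM; first exact: cvg_cst.
exact: (cvg_comp f _ fl (@coord_continuous _ _ _ h k l)).
Qed.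

(** A power of X acts on the range of P i as the same power of mu i, and the P i
    sum to the identity, so the exponential series of X splits into finitely many
    scalar ones. *)
Lemma mexp_spectral (I : finType) (X : M) (mu : I -> C) (P : I -> M) :
  \sum_i P i = 1%:M -> (forall i, X *m P i = mu i *: P i) ->
  mexp X = \sum_i cexp (mu i) *: P i.
Proof.
move=> P1 XP; apply: cvg_lim; first exact: norm_hausdorff.
have XkP k i : X ^+ k *m P i = mu i ^+ k *: P i.
  elim: k => [|k IH]; first by rewrite !expr0 scale1r mul1mx.
  by rewrite exprS -[_ * _]/(_ *m _) -mulmxA IH -scalemxAr XP scalerA -exprSr.
have -> : series (fun k => k`!%:R^-1 *: X ^+ k) =
    fun N => \sum_i cexp_sum (mu i) N *: P i.
  apply/funext => N; rewrite /series /=.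
  under [RHS]eq_bigr do rewrite /cexp_sum /series /= scaler_suml.
  rewrite exchange_big /=; apply: eq_bigr => k _.
  rewrite -[X ^+ k]mulmx1 -P1 mulmx_sumr scaler_sumr; apply: eq_bigr => i _.
  by rewrite XkP scalerA mulrC.
apply: cvg_sumr => i; apply: cvgZ; first exact: cvg_cexp.
exact: cvg_cst.
Qed.

End Matrices.

(** * Spectral sums for Lyapunov equations *)

Section Lyapunov.
Local Open Scope classical_set_scope.
Variables (R : realType) (n : nat) (J : interval R).
Local Notation C := (Cx R).
Local Notation M := 'M[C]_n.+1.
Variables (I : finType) (A : M) (mu : I -> C) (P : I -> M).
Hypothesis P1 : \sum_i P i = 1%:M.
Hypothesis AP : forall i, A *m P i = mu i *: P i.
Hypothesis PA : forall i, P i *m A = mu i *: P i.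
Hypothesis Areal : A ^t* = A^T.

Lemma mul_adj_proj i : A^T *m (P i) ^t* = (mu i)^* *: (P i) ^t*.
Proof. by rewrite -Areal -adjM PA adjZ. Qed.

Lemma adj_proj_mul i : (P i) ^t* *m A^T = (mu i)^* *: (P i) ^t*.
Proof. by rewrite -Areal -adjM AP adjZ. Qed.

Lemma sum_adj_proj : \sum_i (P i) ^t* = 1%:M.
Proof. by rewrite -adj_sum P1 trmx1 map_mx1. Qed.

Lemma sum_proj_mul (X : M) : \sum_i \sum_j P i *m X *m (P j) ^t* = X.
Proof.
under eq_bigr do rewrite -mulmx_sumr sum_adj_proj mulmx1.
by rewrite -mulmx_suml P1 mul1mx.
Qed.

(** The operator X |-> A X + X A^T multiplies P i X (P j)^* by mu i + conj (mu j);
    the sum scales the component of X in each of these eigenspaces by f i j t. *)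
Definition lyapSum (f : I -> I -> R -> C) (X : M) (t : R) : M :=
  \sum_i \sum_j f i j t *: (P i *m X *m (P j) ^t*).

Lemma lyapSum_adj (f : I -> I -> R -> C) (X : M) (t : R) :
  X ^t* = X -> (forall i j, (f i j t)^* = f j i t) ->
  (lyapSum f X t) ^t* = lyapSum f X t.
Proof.
move=> XX ff; rewrite /lyapSum adj_sum; under eq_bigr do rewrite adj_sum.
rewrite exchange_big /=; apply: eq_bigr => i _; apply: eq_bigr => j _.
by rewrite adjZ ff !adjM trmxCK XX mulmxA.
Qed.

Lemma hermPart_lyapSum (f : I -> I -> R -> C) (X : M) (t : R) :
  hermPart (lyapSum f X t) =
  \sum_i \sum_j hermPart (f i j t *: (P i *m X *m (P j) ^t*)).
Proof.
by rewrite /lyapSum hermPart_sum; apply: eq_bigr => i _; rewrite hermPart_sum.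
Qed.

(** In the eigenspace of index (i, j) the equation is the scalar equation
    f' = (mu i + conj (mu j)) f + c, with c = 0 for the free motion and c = 1 for
    the forced one. *)
Lemma lyapSum_solution (f : I -> I -> R -> C) (X : M) (c f0 : C) :
  (forall i j, f i j 0 = f0) ->
  (forall i j t, sderivative J (f i j) t ((mu i + (mu j)^*) * f i j t + c)) ->
  lyapunov_solution J A (c *: X) (f0 *: X) (lyapSum f X).
Proof.
move=> f00 fd; split.
  rewrite /lyapSum -[in RHS](sum_proj_mul X) scaler_sumr; apply: eq_bigr => i _.
  by rewrite scaler_sumr; apply: eq_bigr => j _; rewrite f00.
move=> t tJ; exists (lyapSum (fun i j t => (mu i + (mu j)^*) * f i j t + c) X t).
  rewrite /has_derivative_in /lyapSum.
  have -> : (fun s => toC (s - t)^-1 *: (lyapSum f X s - lyapSum f X t)) =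
     fun s => \sum_i \sum_j (toC (s - t)^-1 * (f i j s - f i j t)) *:
                 (P i *m X *m (P j) ^t*).
    apply/funext => s; rewrite /lyapSum -sumrB scaler_sumr; apply: eq_bigr => i _.
    rewrite -sumrB scaler_sumr; apply: eq_bigr => j _.
    by rewrite -scalerBl scalerA.
  apply: cvg_sumr => i; apply: cvg_sumr => j; apply: cvgZ; first exact: fd.
  exact: cvg_cst.
rewrite -[in RHS](sum_proj_mul X) /lyapSum mulmx_sumr mulmx_suml -!sumrN.
rewrite scaler_sumr -sumrN -!big_split /=; apply: eq_bigr => i _.
rewrite mulmx_sumr mulmx_suml scaler_sumr -!sumrN -!big_split /=.
apply: eq_bigr => j _.
set K := P i *m X *m _.
have -> : A *m (f i j t *: K) = (mu i * f i j t) *: K.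
  by rewrite -scalemxAr /K !mulmxA AP -!scalemxAl scalerA mulrC.
have -> : f i j t *: K *m A^T = ((mu j)^* * f i j t) *: K.
  by rewrite -scalemxAl /K -!mulmxA adj_proj_mul -!scalemxAr scalerA mulrC.
rewrite -scaleNr -!scalerDl -scaleNr; congr (_ *: _); ring.
Qed.

(** Each coordinate P i D (P j)^* solves a homogeneous scalar equation with zero
    initial value, and D is the sum of these coordinates. *)
Lemma lyapunov_homogeneous_eq0 (D : R -> M) :
  0 \in J -> lyapunov_solution J A 0 0 D -> {in J, forall t, D t = 0}.
Proof.
move=> J0 [D0 Dsol] t tJ.
rewrite -[D t]sum_proj_mul big1 // => i _; rewrite big1 // => j _.
apply/matrixP => k h; rewrite [RHS]mxE.
pose q s := (P i *m D s *m (P j) ^t*) k h.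
have q0 : q 0 = 0 by rewrite /q D0 mulmx0 mul0mx mxE.
apply: (scalar_ode_eq0 (w := mu i + (mu j)^*) (q := q) J0 q0 _ tJ) => {t tJ} t tJ.
have [D' D't] := Dsol t tJ.
rewrite oppr0 -addrA addrC => /eqP; rewrite subr_eq0 => /eqP D'E.
have -> : (mu i + (mu j)^*) * q t = (P i *m D' *m (P j) ^t*) k h.
  rewrite -D'E mulmxDr mulmxDl mulmxA PA -!scalemxAl -!mulmxA mul_adj_proj.
  by rewrite -!scalemxAr !mulmxA -scalerDl mxE.
rewrite /sderivative.
have -> : (fun s => toC (s - t)^-1 * (q s - q t)) =
    fun s => (P i *m (toC (s - t)^-1 *: (D s - D t)) *m (P j) ^t*) k h.
  apply/funext => s; rewrite -scalemxAr -scalemxAl mxE mulmxBr mulmxBl.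
  by rewrite [X in _ = _ * X]mxE [X in _ = _ * (_ + X)]mxE.
exact: cvg_mulmx_entry.
Qed.

(** With c = -1 this compares two solutions, with c = 1 it superposes the forced
    and the free motion. *)
Lemma lyapunov_solution_linear (c : C) (Q Q' X X' : M) (S S' : R -> M) :
  lyapunov_solution J A Q X S -> lyapunov_solution J A Q' X' S' ->
  lyapunov_solution J A (c *: Q' + Q) (c *: X' + X) (fun t => c *: S' t + S t).
Proof.
move=> [S0 Sd] [S'0 S'd]; split; first by rewrite S0 S'0.
move=> t tJ; have [D Dt DE] := Sd t tJ; have [D' D't D'E] := S'd t tJ.
exists (c *: D' + D).
  rewrite /has_derivative_in.
  have -> : (fun s => toC (s - t)^-1 *: (c *: S' s + S s - (c *: S' t + S t))) =
    fun s => c *: (toC (s - t)^-1 *: (S' s - S' t)) +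
             toC (s - t)^-1 *: (S s - S t).
    apply/funext => s; rewrite opprD addrACA -scalerBr scalerDr; congr (_ + _).
    by rewrite !scalerA mulrC.
  by apply: cvgD; [apply: cvgZ; [exact: cvg_cst | exact: D't] | exact: Dt].
rewrite [RHS]opprD -scalerN -DE -D'E mulmxDr mulmxDl -scalemxAr -scalemxAl.
by rewrite !scalerDr opprD -scalerN [RHS]addrACA [X in _ = X + _]addrACA.
Qed.

Lemma lyapunov_solution_unique (Q X : M) (S : R -> M) : 0 \in J ->
  lyapunov_solution J A Q X S -> the_lyapunov_solution J A Q X S.
Proof.
move=> J0 Ssol; split=> // S' S'sol t tJ.
have := lyapunov_solution_linear (-1) S'sol Ssol.
rewrite !scaleN1r !addNr => /(lyapunov_homogeneous_eq0 J0)/(_ t tJ)/eqP.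
by rewrite scaleN1r addrC subr_eq0 => /eqP.
Qed.

End Lyapunov.

(** * The companion matrix and its eigenvectors *)

(** companionmx is typed by the size of the polynomial; this form accepts any
    dimension that is equal to it. *)
Lemma char_poly_companion (F : comNzRingType) (p : {poly F}) (m : nat)
    (A : 'M[F]_m) :
  p \is monic -> (size p).-1 = m ->
  (forall i j, A i j =
     if i == m.-1 :> nat then - p`_j else (i.+1 == j :> nat)%:R) ->
  char_poly A = p.
Proof.
move=> pm pE; case: _ / pE A => A AE; rewrite -[RHS]companionmxK //; congr char_poly.
by apply/matrixP => i j; rewrite AE mxE.
Qed.

Section Companion.
Variables (R : realType) (n : nat) (a : 'I_n.+1 -> R).
Local Notation C := (Cx R).

(** The coefficients of N, continued by the leading 1 and then by zeros, so that
    recursions on indices need no bounds. *)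
Definition acoef (k : nat) : C :=
  if (k < n.+1)%N then toC (a (inord k)) else (k == n.+1)%:R.

Lemma acoef_last : acoef n.+1 = 1.
Proof. by rewrite /acoef ltnn eqxx. Qed.

Lemma charNE : charN a = \poly_(k < n.+2) acoef k.
Proof.
have sz : size (\poly_(k < n.+2) acoef k) = n.+2.
  by rewrite size_poly_eq // acoef_last oner_eq0.
apply: char_poly_companion.
- by rewrite monicE lead_coefE sz coef_poly ltnSn acoef_last.
- by rewrite sz.
move=> i j; rewrite mxE coef_poly ltnS ltnW ?ltn_ord // /acoef ltn_ord inord_val.
by rewrite -val_eqE /= [j == _ :> nat]eq_sym.
Qed.

Lemma coef_charN (k : nat) : (charN a)`_k = acoef k.
Proof.
rewrite charNE coef_poly; case: ltnP => // kn; rewrite /acoef ltnNge ltnW //=.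
by rewrite gtn_eqF.
Qed.

(** The entries of yvec without the Hankel matrix: a_r / l + a_(r-1) / l^2 + ...
    for every natural index r. *)
Definition yentry (l : C) (r : nat) : C :=
  \sum_(d < r.+1) acoef (r - d) * l ^- d.+1.

Lemma yvecE (l : C) (r : 'I_n.+1) : l != 0 -> yvec a l r 0 = yentry l r.
Proof.
move=> l0; rewrite /yvec !mxE mulr_sumr.
(* Counting the columns from the last one, d = n - c, the Hankel condition
   n <= r + c becomes d <= r and the index r + c - n becomes r - d. *)
rewrite (reindex_inj rev_ord_inj) /=.
rewrite [RHS](big_ord_widen n.+1 (fun d => acoef (r - d) * l ^- d.+1)) ?ltn_ord //.
rewrite [RHS]big_mkcond; apply: eq_bigr => d _; rewrite !mxE /= subSS.
have dn : (d <= n)%N by rewrite -ltnS.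
have rn : (r <= n)%N by rewrite -ltnS.
have -> : (n <= r + (n - d))%N = (d < r.+1)%N by lia.
case: ltnP => [dr|_]; last by rewrite mul0r mulr0.
have -> : (r + (n - d) - n = r - d)%N by lia.
rewrite /acoef (_ : (r - d < n.+1)%N); last by lia.
rewrite mulrCA; congr (_ * _).
have -> : l ^+ n.+1 = l ^+ d.+1 * l ^+ (n - d).
  by rewrite -exprD; congr (_ ^+ _); lia.
by rewrite invfM mulfVK // expf_neq0.
Qed.

Lemma yentry0 (l : C) : l != 0 -> l * yentry l 0 = acoef 0.
Proof.
by move=> l0; rewrite /yentry big_ord1 subnn expr1 mulrCA mulfV // mulr1.
Qed.

Lemma yentryS (l : C) (r : nat) :
  l != 0 -> l * yentry l r.+1 = acoef r.+1 + yentry l r.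
Proof.
move=> l0; rewrite /yentry big_ord_recl mulrDr subn0 expr1 mulrCA mulfV // mulr1.
congr (_ + _); rewrite mulr_sumr; apply: eq_bigr => d _.
by rewrite lift0 subSS mulrCA [l ^+ d.+2]exprS invfM mulVKf.
Qed.

(** This is where N (l) = 0 enters: l^(n + 1) times the entry is the sum of the
    lower-order terms of N (l), hence - l^(n + 1). *)
Lemma yentry_last (l : C) : l != 0 -> root (charN a) l -> yentry l n = -1.
Proof.
move=> l0; rewrite charNE rootE horner_poly big_ord_recr /= acoef_last mul1r.
rewrite addr_eq0 => /eqP E.
apply: (mulIf (expf_neq0 n.+1 l0)); rewrite mulN1r -E /yentry mulr_suml.
rewrite (reindex_inj rev_ord_inj) /=; apply: eq_bigr => d _.
have dn : (d <= n)%N by rewrite -ltnS.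
rewrite subSS subKn // -mulrA; congr (_ * _).
have -> : l ^+ n.+1 = l ^+ (n - d).+1 * l ^+ d.
  by rewrite -exprD; congr (_ ^+ _); lia.
by rewrite mulKf // expf_neq0.
Qed.

(** Its value at m is the product of yvec l with xvec m. *)
Definition ypoly (l : C) : {poly C} := \poly_(r < n.+1) yentry l r.

(** The recursion for the entries of the left eigenvector is Horner's division of
    - N by X - l. The value of the quotient at the other roots is 0, which gives
    biorthogonality, and its value at l is - N' (l). *)
Lemma mulXB_ypoly (l : C) : l != 0 -> root (charN a) l ->
  ('X - l%:P) * ypoly l = - charN a.
Proof.
move=> l0 rl; apply/polyP => k.
rewrite mulrBl coefB coefXM coefCM coefN coef_charN !coef_poly.
case: k => [|k] /=; first by rewrite yentry0 // sub0r.
have [kn|] := ltnP k.+1 n.+1.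
  by rewrite ltnW // yentryS // opprD addrCA subrr addr0.
rewrite leq_eqVlt => /orP[/eqP[<-]|nk].
  by rewrite ltnSn /= mulr0 subr0 yentry_last // acoef_last.
have -> : (k < n.+1)%N = false by lia.
have acoef_k : acoef k.+1 = 0.
  rewrite /acoef; have -> : (k.+1 < n.+1)%N = false by lia.
  by rewrite gtn_eqF.
by rewrite acoef_k /= mulr0 subr0 oppr0.
Qed.

Lemma yvec_mul_xvec (l m : C) : l != 0 ->
  ((yvec a l)^T *m xvec n m) 0 0 = (ypoly l).[m].
Proof.
move=> l0; rewrite mxE horner_poly; apply: eq_bigr => r _.
by rewrite mxE yvecE // mxE.
Qed.

Lemma deriv_charN_root (l : C) : l != 0 -> root (charN a) l ->
  (ypoly l).[l] = - (charN a)^`().[l].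
Proof.
move=> l0 rl; rewrite -hornerN -derivN -(mulXB_ypoly l0 rl) derivM !hornerE.
by rewrite derivXsubC hornerC subrr mul0r addr0 mul1r.
Qed.

(** For an arbitrary m the defect of the eigenvector equation is concentrated in
    the last row; the case m = - l is needed for the factor N (- l). *)
Lemma companion_xvec (m : C) :
  companion a *m xvec n m = m *: xvec n m - (charN a).[m] *: evec R n.
Proof.
apply/colP => i; rewrite !mxE.
under eq_bigr do rewrite !mxE.
have [->|ni] := eqVneq i ord_max.
  rewrite !eqxx mulr1 charNE horner_poly [\sum_(k < n.+2) _]big_ord_recr /=.
  rewrite acoef_last mul1r.
  rewrite exprS opprD addrCA subrr addr0 -sumrN; apply: eq_bigr => j _.
  by rewrite /acoef ltn_ord inord_val mulNr.
have iln : (i.+1 < n.+1)%N.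
  rewrite ltn_neqAle ltn_ord andbT; apply: contra ni => /eqP[] ni.
  exact/eqP/val_inj.
rewrite (bigD1 (Ordinal iln)) //= eqxx mul1r big1 ?addr0 => [|j].
  by rewrite mulr0 subr0 exprS.
by rewrite -val_eqE /= => /negPf ->; rewrite mul0r.
Qed.

End Companion.

(** * Spectral projections and spectral decompositions *)

Section Spectral.
Local Open Scope classical_set_scope.
Variables (R : realType) (n : nat) (a : 'I_n.+1 -> R) (lam : 'I_n.+1 -> Cx R).
Local Notation C := (Cx R).
Local Notation M := 'M[C]_n.+1.
Local Notation A := (companion a).
Local Notation N := (charN a).
Hypothesis simple_spectrum : injective lam.
Hypothesis spectrum : N = \prod_(i < n.+1) ('X - (lam i)%:P).
Hypothesis lam_sum : forall i j : 'I_n.+1, lam i + lam j != 0.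

Let lam_neq0 i : lam i != 0.
Proof.
have := lam_sum i i; apply: contra => /eqP->; by rewrite addr0.
Qed.

Let rootN_E m : root N m = [exists i, m == lam i].
Proof.
rewrite spectrum rootE horner_prod; apply/prodf_eq0/existsP => -[k].
  by move=> _; rewrite hornerXsubC subr_eq0 => mk; exists k.
by move=> mk; exists k; rewrite // hornerXsubC subr_eq0.
Qed.

Let root_lam i : root N (lam i).
Proof. by rewrite rootN_E; apply/existsP; exists i. Qed.

Let N_opp_neq0 i : N.[- lam i] != 0.
Proof.
rewrite -rootE rootN_E; apply/existsP => -[j /eqP E].
by have := lam_sum i j; rewrite -E subrr eqxx.
Qed.

Let derivN_neq0 i : N^`().[lam i] != 0.
Proof.
rewrite spectrum (bigD1 i) //= derivM derivXsubC mul1r hornerD hornerM.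
rewrite hornerXsubC subrr mul0r addr0 horner_prod; apply/prodf_neq0 => j ji.
by rewrite hornerXsubC subr_eq0; apply: contra ji => /eqP/simple_spectrum->.
Qed.

Lemma charN_conj : map_poly Num.conj N = N.
Proof.
apply/polyP => k; rewrite coef_map coef_charN /acoef /=.
by case: ifP => _; rewrite ?conj_toC ?rmorph_nat.
Qed.

Lemma horner_charN_conj (m : C) : (N.[m])^* = N.[m^*].
Proof. by rewrite -horner_map charN_conj. Qed.

Lemma horner_deriv_charN_conj (m : C) : (N^`().[m])^* = N^`().[m^*].
Proof. by rewrite -horner_map -deriv_map charN_conj. Qed.

(** The conjugate of a root of the real polynomial N is some lam k. *)
Let lam_conj_sum i j : lam i + (lam j)^* != 0.
Proof.
have : root N (lam j)^*.
  by rewrite rootE -horner_charN_conj; have /eqP-> := root_lam j; rewrite conjC0.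
by rewrite rootN_E => /existsP[k /eqP->].
Qed.

Lemma companion_adj : A ^t* = A^T.
Proof.
apply/matrixP => i j; rewrite !mxE.
by case: ifP => _; rewrite ?rmorphN ?rmorph_nat /= ?conj_toC.
Qed.

(** The spectral projection of the companion matrix for the eigenvalue lam i. *)
Definition eigproj (i : 'I_n.+1) : M :=
  (- N^`().[lam i])^-1 *: (xvec n (lam i) *m (yvec a (lam i))^T).

Lemma yvec_xvec i j :
  (yvec a (lam i))^T *m xvec n (lam j) = (- N^`().[lam i] *+ (i == j))%:M.
Proof.
apply/matrixP => u v; rewrite !ord1 yvec_mul_xvec // mxE eqxx mulr1n.
have [<-|ij] := eqVneq i j; first by rewrite deriv_charN_root // mulr1n.
have : (('X - (lam i)%:P) * ypoly a (lam i)).[lam j] == 0.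
  by rewrite mulXB_ypoly // hornerN oppr_eq0; apply: root_lam.
rewrite hornerM hornerXsubC mulf_eq0 subr_eq0 => /orP[/eqP/simple_spectrum E|/eqP//].
by rewrite E eqxx in ij.
Qed.

Lemma eigproj_mul i j : eigproj i *m eigproj j = if i == j then eigproj i else 0.
Proof.
rewrite /eigproj -scalemxAl -scalemxAr -mulmxA [X in _ *m X]mulmxA yvec_xvec.
rewrite mul_scalar_mx -scalemxAr scalerA; have [<-|ij] := eqVneq i j.
  by rewrite mulr1n mulVf ?oppr_eq0 // scale1r.
by rewrite mulr0n mulr0 scale0r scaler0.
Qed.

(** By biorthogonality the matrix of normalized left eigenvectors is a left
    inverse of the matrix of right eigenvectors; a square left inverse is also a
    right inverse. *)
Lemma sum_eigproj : \sum_i eigproj i = 1%:M.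
Proof.
pose X : M := \matrix_(k, i) xvec n (lam i) k 0.
pose Y : M := \matrix_(i, k) ((- N^`().[lam i])^-1 * yvec a (lam i) k 0).
have YX : Y *m X = 1%:M.
  apply/matrixP => i j; rewrite [LHS]mxE.
  transitivity ((- N^`().[lam i])^-1 * ((yvec a (lam i))^T *m xvec n (lam j)) 0 0).
    rewrite [in RHS]mxE mulr_sumr; apply: eq_bigr => k _.
    by rewrite [Y _ _]mxE [X _ _]mxE [_^T _ _]mxE mulrA.
  by rewrite yvec_xvec !mxE eqxx mulr1n mulrnAr mulVf // oppr_eq0.
rewrite -(mulmx1C YX); apply/matrixP => k h; rewrite summxE mxE.
apply: eq_bigr => i _; rewrite [X _ _]mxE [Y _ _]mxE mxE [(_ *m _) _ _]mxE.
by rewrite big_ord1 [_^T _ _]mxE mulrCA.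
Qed.

Lemma companion_eigproj i : A *m eigproj i = lam i *: eigproj i.
Proof.
rewrite /eigproj -scalemxAr mulmxA companion_xvec.
have /eqP-> := root_lam i.
by rewrite scale0r subr0 -scalemxAl scalerA mulrC -scalerA.
Qed.

Lemma eigproj_companion i : eigproj i *m A = lam i *: eigproj i.
Proof.
have E j : eigproj i *m (A *m eigproj j) = if i == j then lam i *: eigproj i else 0.
  rewrite companion_eigproj -scalemxAr eigproj_mul.
  by have [<-|_] := eqVneq i j; rewrite ?scaler0.
rewrite -[LHS]mulmx1 -sum_eigproj mulmx_sumr.
under eq_bigr do rewrite -mulmxA E.
by rewrite -big_mkcond (big_pred1 i) // => j; rewrite eq_sym.
Qed.

(** The last entry of a left eigenvector is -1, so the input vector has the
    component xvec / N' along each eigenvector. *)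
Lemma eigproj_evec i :
  eigproj i *m evec R n = (N^`().[lam i])^-1 *: xvec n (lam i).
Proof.
have ye : (yvec a (lam i))^T *m evec R n = (-1)%:M.
  apply/matrixP => u v; rewrite !ord1 -colE mxE [LHS]mxE.
  by rewrite yvecE // yentry_last // [RHS]mxE mulr1n.
rewrite /eigproj -scalemxAl -mulmxA ye mul_mx_scalar scalerA.
by rewrite invrN mulrN1 opprK.
Qed.

Lemma evec_adj : (evec R n)^T = (evec R n) ^t*.
Proof. by apply/matrixP => u v; rewrite !mxE rmorph_nat. Qed.

Lemma xvec_signMx (m : C) : (xvec n m)^T *m signMx R n = - (xvec n (- m))^T.
Proof.
apply/rowP => k; rewrite /signMx mul_mx_diag !mxE.
by rewrite exprS mulN1r mulrN [in RHS]exprNn mulrC.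
Qed.

Lemma evec_eigproj_adj j : (evec R n)^T *m (eigproj j) ^t* =
  (N^`().[(lam j)^*])^-1 *: (xvec n (lam j)) ^t*.
Proof.
by rewrite evec_adj -adjM eigproj_evec adjZ fmorphV /= horner_deriv_charN_conj.
Qed.

(** The row xvec^T signMx / N (- l) is the resolvent row e_n^T (l I + A^T)^-1,
    because signMx turns xvec l into - xvec (- l), and companion_xvec at - l has
    the defect N (- l). On the range of the adjoint projection the resolvent is
    division by l + conj (lam j). *)
Lemma xvec_signMx_eigproj i j :
  (xvec n (lam i))^T *m signMx R n *m (eigproj j) ^t* =
  (N.[- lam i] / (lam i + (lam j)^*) / N^`().[(lam j)^*]) *: (xvec n (lam j)) ^t*.
Proof.
rewrite xvec_signMx; set V := xvec n (- lam i); set Pj := (eigproj j) ^t*.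
have APj : A^T *m Pj = (lam j)^* *: Pj.
  by rewrite -companion_adj -adjM eigproj_companion adjZ.
have E : (lam j)^* *: (V^T *m Pj) =
    - lam i *: (V^T *m Pj) - N.[- lam i] *: ((evec R n)^T *m Pj).
  rewrite scalemxAr -APj mulmxA -trmx_mul companion_xvec.
  by rewrite linearB 2!linearZ mulmxBl -!scalemxAl.
have {}E : (lam i + (lam j)^*) *: (- V^T *m Pj) =
    N.[- lam i] *: ((evec R n)^T *m Pj).
  by rewrite mulNmx scalerN scalerDl E addrA scaleNr subrr sub0r opprK.
apply: (scalerI (lam_conj_sum i j)); rewrite E evec_eigproj_adj !scalerA.
by congr (_ *: _); rewrite mulrA mulrCA mulfV ?mulr1.
Qed.

(** The coordinates of the input matrix have rank one, which turns the general
    spectral sum into the expressions in xvec alone. *)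
Lemma eigproj_input i j :
  eigproj i *m (evec R n *m (evec R n)^T) *m (eigproj j) ^t* =
  (N^`().[lam i] * N^`().[(lam j)^*])^-1 *:
    (xvec n (lam i) *m (xvec n (lam j)) ^t*).
Proof.
rewrite evec_adj; have := eigproj_evec i; have := eigproj_evec j.
move: (eigproj i) (eigproj j) (evec R n) (xvec n _) (xvec n _).
move=> Pi Pj e xi xj Ej Ei.
have -> : Pi *m (e *m e ^t*) *m Pj ^t* = (Pi *m e) *m (Pj *m e) ^t*.
  by rewrite adjM !mulmxA.
rewrite Ej Ei adjZ -scalemxAl -scalemxAr scalerA.
by rewrite fmorphV /= horner_deriv_charN_conj invfM.
Qed.

Lemma shiftExpE i t : shiftExp a (lam i) t =
  \sum_j cexp ((lam i + (lam j)^*) * toC t) *: (eigproj j) ^t*.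
Proof.
apply: mexp_spectral => [|j]; first by rewrite -adj_sum sum_eigproj trmx1 map_mx1.
rewrite -scalemxAl mulmxDl mul_scalar_mx -adjM eigproj_companion adjZ.
by rewrite -scalerDl scalerA mulrC.
Qed.

Definition expCoeff i j t : C := cexp ((lam i + (lam j)^*) * toC t).
(** The integral of expCoeff over [0, t]; the solution of f' = w f + 1 with
    f (0) = 0. *)
Definition intExpCoeff i j t : C := (expCoeff i j t - 1) / (lam i + (lam j)^*).

(** Expanding the matrix exponential over the adjoint projections turns the single
    sum into a double one. *)
Lemma P0term1_sum (X : M) t :
  \sum_i P0term1 a X (lam i) t = hermPart (lyapSum eigproj expCoeff X t).
Proof.
rewrite /lyapSum hermPart_sum; apply: eq_bigr => i _; congr hermPart.
rewrite shiftExpE mulmx_sumr scaler_sumr; apply: eq_bigr => j _.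
set Pj := (eigproj j) ^t*; rewrite -scalemxAr scalerA mulrC -scalerA.
by rewrite /eigproj -!scalemxAl.
Qed.

Lemma P0term2_sum (X : M) t :
  \sum_i \sum_j P0term2 a X (lam i) (lam j) t =
  hermPart (lyapSum eigproj expCoeff X t).
Proof.
rewrite hermPart_lyapSum; apply: eq_bigr => i _; apply: eq_bigr => j _.
congr (hermPart (_ *: _)).
rewrite {2}/eigproj adjZ adjM fmorphV /= rmorphN /= horner_deriv_charN_conj.
rewrite -scalemxAr /eigproj -!scalemxAl scalerA !mulmxA; congr (_ *: _).
by rewrite -invfM mulrNN mulrC.
Qed.

Lemma PCterm2_sum t :
  \sum_i \sum_j PCterm2 a (lam i) (lam j) t =
  hermPart (lyapSum eigproj intExpCoeff (evec R n *m (evec R n)^T) t).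
Proof.
rewrite hermPart_lyapSum; apply: eq_bigr => i _; apply: eq_bigr => j _.
by rewrite eigproj_input.
Qed.

(** Expanding the matrix exponential over the adjoint projections turns the single
    sum into the double one; N (- lam i) cancels by xvec_signMx_eigproj. *)
Lemma PCterm1_sum t :
  \sum_i PCterm1 a (lam i) t =
  hermPart (lyapSum eigproj intExpCoeff (evec R n *m (evec R n)^T) t).
Proof.
rewrite /lyapSum hermPart_sum; apply: eq_bigr => i _; congr hermPart.
have -> : shiftExp a (lam i) t - 1%:M =
    \sum_j (expCoeff i j t - 1) *: (eigproj j) ^t*.
  rewrite shiftExpE -(sum_adj_proj sum_eigproj) -sumrB; apply: eq_bigr => j _.
  by rewrite scalerBl scale1r.
rewrite mulmx_sumr scaler_sumr; apply: eq_bigr => j _.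
rewrite eigproj_input -scalemxAr -!mulmxA [_^T *m _]mulmxA xvec_signMx_eigproj.
rewrite -scalemxAr !scalerA; congr (_ *: _); rewrite /intExpCoeff !invfM.
have cancel_middle (u v x w y : C) : v != 0 ->
    u / v * (x * (v / w * y)) = x / w * (u * y).
  move=> v0; have -> : u / v * (x * (v / w * y)) = v / v * (x / w * (u * y)) by ring.
  by rewrite mulfV // mul1r.
exact: cancel_middle.
Qed.

Lemma expCoeff0 i j : expCoeff i j 0 = 1.
Proof. by rewrite /expCoeff rmorph0 mulr0 cexp0. Qed.

Lemma sderivative_expCoeff (J : interval R) i j t :
  sderivative J (expCoeff i j) t ((lam i + (lam j)^*) * expCoeff i j t + 0).
Proof. by rewrite addr0; exact: (sderivative_cexp J _ t). Qed.

Arguments sderivative_expCoeff J i j t _ _ : clear implicits.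

Lemma sderivative_intExpCoeff (J : interval R) i j t :
  sderivative J (intExpCoeff i j) t ((lam i + (lam j)^*) * intExpCoeff i j t + 1).
Proof.
have -> : (lam i + (lam j)^*) * intExpCoeff i j t + 1 = expCoeff i j t.
  by rewrite /intExpCoeff mulrCA mulfV ?lam_conj_sum // mulr1 subrK.
rewrite /sderivative.
have -> : (fun s => toC (s - t)^-1 * (intExpCoeff i j s - intExpCoeff i j t)) =
    fun s => toC (s - t)^-1 * (expCoeff i j s - expCoeff i j t) *
             (lam i + (lam j)^*)^-1.
  apply/funext => s; rewrite /intExpCoeff -mulrBl -mulrA; congr (_ * (_ * _)).
  by rewrite opprB addrA subrK.
have E : (lam i + (lam j)^*) * expCoeff i j t * (lam i + (lam j)^*)^-1 =
    expCoeff i j t.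
  by rewrite mulrAC mulfV ?lam_conj_sum // mul1r.
rewrite -[X in _ --> X]E; apply: cvgM; last exact: cvg_cst.
have := sderivative_expCoeff J i j t; rewrite addr0; exact.
Qed.

Arguments sderivative_intExpCoeff J i j t _ _ : clear implicits.

Lemma conj_expCoeff i j t : (expCoeff i j t)^* = expCoeff j i t.
Proof.
rewrite /expCoeff conj_cexp rmorphM rmorphD /= conjCK conj_toC.
by rewrite addrC.
Qed.

Lemma conj_intExpCoeff i j t : (intExpCoeff i j t)^* = intExpCoeff j i t.
Proof.
rewrite /intExpCoeff rmorphM fmorphV rmorphB rmorph1 rmorphD /= conj_expCoeff conjCK.
by rewrite [_^* + _]addrC.
Qed.

Lemma input_solution (J : interval R) :
  lyapunov_solution J A (evec R n *m (evec R n)^T) 0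
    (lyapSum eigproj intExpCoeff (evec R n *m (evec R n)^T)).
Proof.
have f0 i j : intExpCoeff i j 0 = 0.
  by rewrite /intExpCoeff expCoeff0 subrr mul0r.
have := lyapSum_solution sum_eigproj companion_eigproj companion_adj
  (evec R n *m (evec R n)^T) f0 (sderivative_intExpCoeff J).
by rewrite scale1r scale0r.
Qed.

Lemma initial_solution (J : interval R) (X : M) :
  lyapunov_solution J A 0 X (lyapSum eigproj expCoeff X).
Proof.
have := lyapSum_solution sum_eigproj companion_eigproj companion_adj
  X expCoeff0 (sderivative_expCoeff J).
by rewrite scale1r scale0r.
Qed.

Lemma companion_lyapunov_unique (J : interval R) (Q X : M) (S : R -> M) :
  0 \in J -> lyapunov_solution J A Q X S -> the_lyapunov_solution J A Q X S.
Proof.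
exact: (lyapunov_solution_unique sum_eigproj eigproj_companion companion_adj).
Qed.

(** The forced motion is Hermitian, hence equal to its Hermitian part. *)
Lemma input_adj (t : R) :
  (lyapSum eigproj intExpCoeff (evec R n *m (evec R n)^T) t) ^t* =
  lyapSum eigproj intExpCoeff (evec R n *m (evec R n)^T) t.
Proof.
apply: lyapSum_adj => [|i j]; last exact: conj_intExpCoeff.
by rewrite evec_adj adjM trmxCK.
Qed.

End Spectral.

Unset Implicit Arguments.
Set Strict Implicit.
Set Printing Implicit Defensive.

Theorem mainTheorem2 (R : realType) (n : nat) (a : 'I_n.+1 -> R)
    (lam : 'I_n.+1 -> Cx R) (P0 : 'M[Cx R]_n.+1) (J : interval R)
    (simple_spectrum : injective lam)
    (spectrum : charN a = \prod_(i < n.+1) ('X - (lam i)%:P))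
    (lam_sum : forall i j : 'I_n.+1, lam i + lam j != 0)
    (P0_neq0 : P0 != 0)
    (J0 : 0 \in J) :
  exists PC PC0 : R -> 'M[Cx R]_n.+1,
    [/\ the_lyapunov_solution J (companion a) (evec R n *m (evec R n)^T) P0
          (fun t => PC t + PC0 t),
        the_lyapunov_solution J (companion a) (evec R n *m (evec R n)^T) 0 PC,
        the_lyapunov_solution J (companion a) 0 P0 PC0,
        (forall t : R, t \in J ->
           PC t = \sum_(i < n.+1) PCterm1 a (lam i) t /\
           PC t = \sum_(i < n.+1) \sum_(j < n.+1) PCterm2 a (lam i) (lam j) t)
      & (forall t : R, t \in J ->
           [/\ hermPart (PC0 t) = \sum_(i < n.+1) P0term1 a P0 (lam i) t,
               hermPart (PC0 t) =
                 \sum_(i < n.+1) \sum_(j < n.+1)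
                   P0term2 a P0 (lam i) (lam j) t
             & P0 ^t* = P0 ->
               PC0 t = \sum_(i < n.+1) P0term1 a P0 (lam i) t /\
               PC0 t =
                 \sum_(i < n.+1) \sum_(j < n.+1)
                   P0term2 a P0 (lam i) (lam j) t])].
Proof.
have PCsol := input_solution simple_spectrum spectrum lam_sum J.
have PC0sol := initial_solution simple_spectrum spectrum lam_sum J P0.
have uniq Q X S := @companion_lyapunov_unique _ _ _ _
  simple_spectrum spectrum lam_sum J Q X S J0.
set ee := evec R n *m (evec R n)^T in PCsol *.
exists (lyapSum (eigproj a lam) (intExpCoeff lam) ee).
exists (lyapSum (eigproj a lam) (expCoeff lam) P0).
split.
- apply: uniq; have := lyapunov_solution_linear 1 PC0sol PCsol.
  by rewrite !scale1r addr0 add0r; under eq_fun do rewrite scale1r.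
- exact: uniq.
- exact: uniq.
- move=> t _; have H := hermPart_id (input_adj a lam t).
  split; apply: (etrans (esym H)); apply: esym.
    exact: PCterm1_sum.
  exact: PCterm2_sum.
- move=> t _.
  have S1 : \sum_i P0term1 a P0 (lam i) t =
      hermPart (lyapSum (eigproj a lam) (expCoeff lam) P0 t).
    exact: P0term1_sum.
  have S2 : \sum_i \sum_j P0term2 a P0 (lam i) (lam j) t =
      hermPart (lyapSum (eigproj a lam) (expCoeff lam) P0 t).
    exact: P0term2_sum.
  split; [exact: esym S1 | exact: esym S2 |] => P0_adj.
  have H := hermPart_id (lyapSum_adj (eigproj a lam) P0_adj
    (fun i j => conj_expCoeff lam i j t)).
  by split; apply: (etrans (esym H)); apply: esym.
Qed.
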